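(* Let $f:\mathbb R^d\to\mathbb R$ be twice continuously differentiable with $\|\nabla^2 f(x)-\nabla^2 f(y)\|\le L\|x-y\|$ for all $x,y\in\mathbb R^d$. Let $x_{j+1}=x_j+s_j$ be a sequence of iterates and let $y_i=\nabla f(x_{i+1})-\nabla f(x_i)$. Let $B_k$ be a $d\times d$ matrix (a Quasi-Newton approximation at iteration $k$) satisfying the secant condition $B_k s_i=y_i$ for all $i$ in an index set $\mathcal M_k$. Then for any $i\in\mathcal M_k$ with $i\le k-1$, $$\big\|(B_k-\nabla^2 f(x_k))\,s_i\big\|\;\le\;L\,\|s_i\|\,\sum_{j=i}^{k-1}\|s_j\|.$$
   Context: $\|\cdot\|$ is the Euclidean norm for vectors and the spectral norm for matrices. $\mathcal M_k$ is the set of indices of the recent curvature pairs $(s_i,y_i)$ kept in memory by the Quasi-Newton method at iteration $k$. *)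

(* Defs.v *)
From HB Require Import structures.
From mathcomp Require Import all_boot all_order all_algebra.
From mathcomp Require Import all_classical all_reals all_analysis.
Set Implicit Arguments.
Unset Strict Implicit.
Unset Printing Implicit Defensive.
Import Order.TTheory GRing.Theory Num.Theory.
Import numFieldNormedType.Exports.
Local Open Scope classical_set_scope.
Local Open Scope ring_scope.

(* The library norm `| _ | on matrices (column vectors included) is the
   max-entry norm; it induces the topology used by [differentiable] and
   [continuous] below, but it is neither of the two norms defined here. *)
Definition enorm (R : realType) (d : nat) (v : 'cV[R]_d) : R :=
  Num.sqrt (\sum_(i < d) v i 0 ^+ 2).

(* The operator norm induced by [enorm]. The set is nonempty and bounded, so
   the supremum is never the default value of [sup]. *)
Definition spectral_norm (R : realType) (d : nat) (A : 'M[R]_d) : R :=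
  sup [set enorm (A *m v) | v in [set v : 'cV[R]_d | enorm v <= 1]].

Definition gradient (R : realType) (d : nat) (f : 'cV[R]_d -> R)
    (x : 'cV[R]_d) : 'cV[R]_d :=
  \col_(i < d) 'D_(delta_mx i 0) f x.

(* Row i is the derivative of the i-th component of the gradient, so this is
   the Jacobian matrix of the gradient, acting on column vectors by [*m]. *)
Definition hessian (R : realType) (d : nat) (f : 'cV[R]_d -> R)
    (x : 'cV[R]_d) : 'M[R]_d :=
  \matrix_(i < d, j < d) 'D_(delta_mx j 0) ('D_(delta_mx i 0) f) x.

(* Frechet differentiability of f and of its gradient. It guarantees that the
   partial derivatives above exist, 'D being total. *)
Definition twice_continuously_differentiable (R : realType) (d : nat)
    (f : 'cV[R]_d -> R) : Prop :=
  [/\ forall x, differentiable f x,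
      forall x, differentiable (gradient f) x
    & continuous (hessian f)].

(* Main.v *)
Require Import Defs.
From HB Require Import structures.
From mathcomp Require Import all_boot all_order all_algebra.
From mathcomp Require Import all_classical all_reals all_analysis.
From mathcomp Require Import ring lra.
Set Implicit Arguments.
Unset Strict Implicit.
Unset Printing Implicit Defensive.
Import Order.TTheory GRing.Theory Num.Theory.
Import numFieldNormedType.Exports.
Local Open Scope classical_set_scope.
Local Open Scope ring_scope.

(** By the secant condition, [(Bk - hessian f (x k)) *m s i] is the error
    made by predicting the gradient increment along the step [s i] from the
    Hessian at the later point [x k]:
    [gradient f (x i + s i) - gradient f (x i) - hessian f (x k) *m s i].

    The usual argument writes this error as the integral over t in [0, 1] of
    [(hessian f (x i + t *: s i) - hessian f (x k)) *m s i].  A scalar mean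
    value theorem takes the place of this integral.  Calling the error [w], the
    number [enorm w ^+ 2] is the inner product of [w] with [w] itself, and the
    mean value theorem applied to [t |-> dot w (gradient f (x i + t *: s i))]
    turns it into
    [dot w (hessian f z *m s i - hessian f (x k) *m s i)]
    for a single point [z = x i + c *: s i] with [0 < c < 1].  Cauchy-Schwarz
    and the operator norm inequality, after division by [enorm w], leave
    [enorm w <= spectral_norm (hessian f z - hessian f (x k)) * enorm (s i)]
    ([gradient_linearization_error]).

    The Lipschitz hypothesis bounds the spectral norm by
    [L * enorm (z - x k)].  The polygonal path from [z] to [x i.+1] and then
    through the iterates to [x k] has length at most the sum of the
    [enorm (s j)], since [z] already lies on the first step
    ([enorm_segment_to_iterate]). *)

(** * Euclidean norm and inner product *)

Definition dot (R : realType) (d : nat) (u v : 'cV[R]_d) : R :=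
  \sum_(i < d) u i 0 * v i 0.

Lemma dotDr (R : realType) (d : nat) (u v w : 'cV[R]_d) :
  dot u (v + w) = dot u v + dot u w.
Proof.
by rewrite /dot -big_split; apply: eq_bigr => i _; rewrite mxE mulrDr.
Qed.

Lemma dotNr (R : realType) (d : nat) (u v : 'cV[R]_d) :
  dot u (- v) = - dot u v.
Proof.
by rewrite /dot -sumrN; apply: eq_bigr => i _; rewrite mxE mulrN.
Qed.

Lemma dotBr (R : realType) (d : nat) (u v w : 'cV[R]_d) :
  dot u (v - w) = dot u v - dot u w.
Proof. by rewrite dotDr dotNr. Qed.

Lemma enorm_ge0 (R : realType) (d : nat) (v : 'cV[R]_d) : 0 <= enorm v.
Proof. exact: sqrtr_ge0. Qed.

Lemma sqr_enorm (R : realType) (d : nat) (v : 'cV[R]_d) :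
  enorm v ^+ 2 = \sum_(i < d) v i 0 ^+ 2.
Proof. by rewrite sqr_sqrtr // sumr_ge0 // => i _; rewrite sqr_ge0. Qed.

Lemma dot_self (R : realType) (d : nat) (v : 'cV[R]_d) :
  dot v v = enorm v ^+ 2.
Proof. by rewrite sqr_enorm; apply: eq_bigr => i _; rewrite expr2. Qed.

Lemma enorm_eq0 (R : realType) (d : nat) (v : 'cV[R]_d) :
  enorm v = 0 -> v = 0.
Proof.
move=> v0; apply/matrixP => i j; rewrite (ord1 j) mxE.
have := sqr_enorm v; rewrite v0 expr0n => /esym/eqP.
rewrite psumr_eq0 => [/allP/(_ i)|l _]; last exact: sqr_ge0.
by rewrite mem_index_enum => /(_ isT); rewrite sqrf_eq0 => /eqP.
Qed.

Lemma enorm0 (R : realType) (d : nat) : enorm (0 : 'cV[R]_d) = 0.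
Proof. by rewrite /enorm big1 ?sqrtr0 // => i _; rewrite mxE expr0n. Qed.

Lemma enormZ (R : realType) (d : nat) (a : R) (v : 'cV[R]_d) :
  enorm (a *: v) = `|a| * enorm v.
Proof.
rewrite /enorm -(sqrtr_sqr a) -sqrtrM ?sqr_ge0 // mulr_sumr.
by congr Num.sqrt; apply: eq_bigr => i _; rewrite mxE exprMn.
Qed.

Lemma enormN (R : realType) (d : nat) (v : 'cV[R]_d) : enorm (- v) = enorm v.
Proof. by rewrite -scaleN1r enormZ normrN1 mul1r. Qed.

(** With a and b the norms of u and v, expanding the sum of the squares of the
    entries of [b *: u - a *: v] gives 2ab(ab - <u, v>), which is therefore
    nonnegative; the factor 2ab can be cancelled unless u or v vanishes. *)
Lemma cauchy_schwarz (R : realType) (d : nat) (u v : 'cV[R]_d) :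
  dot u v <= enorm u * enorm v.
Proof.
have [/enorm_eq0 ->|u0] := eqVneq (enorm u) 0.
  by rewrite enorm0 mul0r /dot big1 // => i _; rewrite mxE mul0r.
have [/enorm_eq0 ->|v0] := eqVneq (enorm v) 0.
  by rewrite enorm0 mulr0 /dot big1 // => i _; rewrite mxE mulr0.
have ab0 : 0 < enorm u * enorm v.
  by rewrite mulr_gt0 // lt_neqAle eq_sym ?u0 ?v0 enorm_ge0.
have : 0 <= \sum_(i < d) (enorm v * u i 0 - enorm u * v i 0) ^+ 2.
  by apply: sumr_ge0 => i _; rewrite sqr_ge0.
have -> : \sum_(i < d) (enorm v * u i 0 - enorm u * v i 0) ^+ 2
        = 2 * (enorm u * enorm v) * (enorm u * enorm v - dot u v).
  transitivity (enorm v ^+ 2 * \sum_(i < d) u i 0 ^+ 2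
                + enorm u ^+ 2 * \sum_(i < d) v i 0 ^+ 2
                - 2 * (enorm u * enorm v) * dot u v).
    rewrite /dot !mulr_sumr -big_split -sumrB; apply: eq_bigr => i _ /=.
    by ring.
  by rewrite -!sqr_enorm; ring.
by rewrite pmulr_rge0 ?subr_ge0 // mulr_gt0 // ltr0n.
Qed.

Lemma enormD (R : realType) (d : nat) (u v : 'cV[R]_d) :
  enorm (u + v) <= enorm u + enorm v.
Proof.
rewrite -(@ler_pXn2r _ 2) ?nnegrE ?addr_ge0 ?enorm_ge0 //.
have -> : enorm (u + v) ^+ 2 = enorm u ^+ 2 + 2 * dot u v + enorm v ^+ 2.
  rewrite (sqr_enorm (u + v)) (sqr_enorm u) (sqr_enorm v) /dot mulr_sumr.
  rewrite -!big_split /=.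
  by apply: eq_bigr => i _; rewrite mxE; ring.
by have := cauchy_schwarz u v; nra.
Qed.

Lemma enorm_sum (R : realType) (d : nat) (I : Type) (r : seq I)
    (v : I -> 'cV[R]_d) :
  enorm (\sum_(j <- r) v j) <= \sum_(j <- r) enorm (v j).
Proof.
elim/big_ind2 : _ => [|u a w b ua wb|//]; first by rewrite enorm0.
exact: le_trans (enormD _ _) (lerD ua wb).
Qed.

(** * The spectral norm as an operator norm *)

(** Cauchy-Schwarz on each row shows that the Frobenius norm of A is a suitable
    constant.  Its only purpose is to make the supremum defining
    [spectral_norm] a genuine least upper bound. *)
Lemma enorm_mulmx_bounded (R : realType) (d : nat) (A : 'M[R]_d) :
  exists C, forall v : 'cV[R]_d, enorm (A *m v) <= C * enorm v.
Proof.
pose S := \sum_(i < d) enorm (row i A)^T ^+ 2.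
have S0 : 0 <= S by apply: sumr_ge0 => i _; rewrite sqr_ge0.
exists (Num.sqrt S) => v.
rewrite -(@ler_pXn2r _ 2) ?nnegrE ?mulr_ge0 ?enorm_ge0 ?sqrtr_ge0 //.
rewrite exprMn (sqr_sqrtr S0) (sqr_enorm (A *m v)) mulr_suml; apply: ler_sum => i _.
have -> : (A *m v) i 0 = dot (row i A)^T v.
  by rewrite mxE; apply: eq_bigr => j _; rewrite !mxE.
have h1 := cauchy_schwarz (row i A)^T v.
have := cauchy_schwarz (row i A)^T (- v); rewrite enormN dotNr => h2.
rewrite -exprMn -real_normK ?num_real //.
rewrite ler_pXn2r ?nnegrE ?mulr_ge0 ?enorm_ge0 //.
by rewrite ler_norml h1 lerNl h2.
Qed.

Lemma enorm_mulmx_ball_ubound (R : realType) (d : nat) (A : 'M[R]_d) :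
  has_ubound [set enorm (A *m v) | v in [set v : 'cV[R]_d | enorm v <= 1]].
Proof.
have [C hC] := enorm_mulmx_bounded A.
exists `|C| => _ [v /= v1 <-]; apply: (le_trans (hC v)).
rewrite -[leRHS]mulr1; apply: le_trans (ler_wpM2l (normr_ge0 C) v1).
by rewrite ler_wpM2r ?enorm_ge0 ?ler_norm.
Qed.

Lemma spectral_norm_ge0 (R : realType) (d : nat) (A : 'M[R]_d) :
  0 <= spectral_norm A.
Proof.
apply: ub_le_sup; first exact: enorm_mulmx_ball_ubound.
by exists 0; rewrite /= ?mulmx0 enorm0 // ler01.
Qed.

Lemma enorm_mulmx_le (R : realType) (d : nat) (A : 'M[R]_d) (v : 'cV[R]_d) :
  enorm (A *m v) <= spectral_norm A * enorm v.
Proof.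
have [/enorm_eq0 ->|v0] := eqVneq (enorm v) 0.
  by rewrite mulmx0 enorm0 mulr0.
have v_gt0 : 0 < enorm v by rewrite lt_neqAle eq_sym v0 enorm_ge0.
rewrite -ler_pdivrMr //; apply: ub_le_sup; first exact: enorm_mulmx_ball_ubound.
have inv_norm : `|(enorm v)^-1| = (enorm v)^-1.
  by rewrite ger0_norm // invr_ge0 enorm_ge0.
exists ((enorm v)^-1 *: v) => /=; first by rewrite enormZ inv_norm mulVf.
by rewrite -scalemxAr enormZ inv_norm mulrC.
Qed.

(** * A mean value theorem for the gradient *)

(** The difference quotient of [r |-> g (a + r *: v)] at [t] in direction 1 is
    literally that of [g] at [a + t *: v] in direction [v]. *)
Lemma is_derive_line (R : realType) (V W : normedModType R) (g : V -> W)
    (a v : V) (t : R) (dg : W) :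
  is_derive (a + t *: v) v g dg ->
  is_derive t 1 (fun r : R => g (a + r *: v)) dg.
Proof.
have quotE : (fun h : R => h^-1 *:
      (((fun r : R => g (a + r *: v)) \o shift t) (h *: 1) - g (a + t *: v)))
    = (fun h : R => h^-1 *:
      ((g \o shift (a + t *: v)) (h *: v) - g (a + t *: v))).
  apply/funext => h /=; congr (_ *: (g _ - _)).
  by rewrite /GRing.scale /= mulr1 -/(GRing.scale _ _) scalerDl addrCA.
move=> [dv <-]; apply: DeriveDef; first by rewrite /derivable quotE.
by rewrite /derive quotE.
Qed.

(** Differentiability of the gradient makes the directional derivative linear
    in the direction, so that it is determined by the second partial
    derivatives collected in the Hessian. *)
Lemma is_derive_partial (R : realType) (d : nat) (f : 'cV[R]_d -> R)
    (z v : 'cV[R]_d) (i : 'I_d) :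
  differentiable (gradient f) z ->
  is_derive z v ('D_(delta_mx i 0) f) ((hessian f z *m v) i 0).
Proof.
move=> dgrad.
have dpart : differentiable ('D_(delta_mx i 0) f) z.
  have -> : 'D_(delta_mx i 0) f
      = (fun N : 'cV[R]_d => N i 0 : R) \o gradient f.
    by apply/funext => p; rewrite /= mxE.
  exact: differentiable_comp dgrad (differentiable_coord _ _ _).
apply: DeriveDef; first exact: diff_derivable.
rewrite deriveE // [X in 'd _ _ X](matrix_sum_delta v) linear_sum mxE.
apply: eq_bigr => j _; rewrite big_ord1 linearZ mxE -deriveE //=.
exact: mulrC.
Qed.

Lemma is_derive_dot_gradient (R : realType) (d : nat) (f : 'cV[R]_d -> R)
    (w z v : 'cV[R]_d) :
  differentiable (gradient f) z ->
  is_derive z v (fun p => dot w (gradient f p)) (dot w (hessian f z *m v)).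
Proof.
move=> dgrad.
have -> : (fun p => dot w (gradient f p))
    = \sum_(i < d) (w i 0 \*: 'D_(delta_mx i 0) f).
  by apply/funext => p; rewrite fct_sumE; apply: eq_bigr => i _; rewrite mxE.
apply: is_derive_sum => i; apply: is_deriveZ; exact: is_derive_partial.
Qed.

(** The mean value theorem fails for vector-valued functions, hence the fixed
    vector [w]: the intermediate point depends on it. *)
Lemma gradient_mean_value (R : realType) (d : nat) (f : 'cV[R]_d -> R)
    (w a v : 'cV[R]_d) :
  (forall z, differentiable (gradient f) z) ->
  exists2 c : R, c \in `]0, 1[ &
    dot w (gradient f (a + v) - gradient f a)
      = dot w (hessian f (a + c *: v) *m v).
Proof.
move=> dgrad; pose phi (t : R) := dot w (gradient f (a + t *: v)).
have dphi (t : R) : is_derive t 1 phi (dot w (hessian f (a + t *: v) *m v)).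
  exact: (is_derive_line (is_derive_dot_gradient _ _ _)).
have cphi : continuous phi.
  move=> t; apply: differentiable_continuous; apply/derivable1_diffP.
  exact: (@ex_derive _ _ _ _ _ _ _ (dphi t)).
have [c c01 phiE] := MVT ltr01 (fun t _ => dphi t) (continuous_subspaceT cphi).
exists c => //; move: phiE.
by rewrite /phi scale1r scale0r addr0 subr0 mulr1 dotBr.
Qed.

(** [gradient_mean_value] is used with the error itself as test vector [w],
    so that the left-hand side becomes the square of its norm. *)
Lemma gradient_linearization_error (R : realType) (d : nat)
    (f : 'cV[R]_d -> R) (M : 'M[R]_d) (a v : 'cV[R]_d) :
  (forall z, differentiable (gradient f) z) ->
  exists2 c : R, c \in `]0, 1[ &
    enorm (gradient f (a + v) - gradient f a - M *m v)
      <= spectral_norm (hessian f (a + c *: v) - M) * enorm v.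
Proof.
move=> dgrad; set w := _ - M *m v.
have [c c01 gradE] := gradient_mean_value w a v dgrad.
exists c => //; have [->|w0] := eqVneq (enorm w) 0.
  by rewrite mulr_ge0 ?enorm_ge0 ?spectral_norm_ge0.
have w_gt0 : 0 < enorm w by rewrite lt_neqAle eq_sym w0 enorm_ge0.
rewrite -(ler_pM2l w_gt0) -expr2 -dot_self {2}/w dotBr gradE -dotBr -mulmxBl.
apply: le_trans (cauchy_schwarz _ _) _.
by rewrite ler_pM2l // enorm_mulmx_le.
Qed.

(** * The estimate along the iterates *)

(** The remaining part [(1 - c) *: s i] of the first step and the steps from
    [x i.+1] on form a path from the given point to [x k]. *)
Lemma enorm_segment_to_iterate (R : realType) (d : nat) (x s : nat -> 'cV[R]_d)
    (i k : nat) (c : R) :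
  (forall j, x j.+1 = x j + s j) -> (i < k)%N -> 0 <= c <= 1 ->
  enorm (x i + c *: s i - x k) <= \sum_(i <= j < k) enorm (s j).
Proof.
move=> x_step i_lt_k /andP[c0 c1].
have -> : x i + c *: s i - x k
    = - ((1 - c) *: s i + \sum_(i.+1 <= j < k) s j).
  have <- : x k - x i.+1 = \sum_(i.+1 <= j < k) s j.
    rewrite -telescope_sumr //; apply: eq_bigr => j _.
    by rewrite x_step addrC addKr.
  rewrite x_step scalerBl scale1r; apply/matrixP => p q; rewrite !mxE; ring.
rewrite enormN [leRHS]big_ltn //; apply: le_trans (enormD _ _) _.
apply: lerD; last exact: enorm_sum.
rewrite enormZ ger0_norm ?subr_ge0 // ler_piMl ?enorm_ge0 //.
by rewrite lerBlDr lerDl.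
Qed.

Theorem lemma10 (R : realType) (d : nat) (f : 'cV[R]_d -> R) (L : R)
  (f_C2 : twice_continuously_differentiable f)
  (hess_lip : forall x y : 'cV[R]_d,
     spectral_norm (hessian f x - hessian f y) <= L * enorm (x - y))
  (x s y : nat -> 'cV[R]_d)
  (x_step : forall j : nat, x j.+1 = x j + s j)
  (y_def : forall i : nat, y i = gradient f (x i.+1) - gradient f (x i))
  (k : nat) (Bk : 'M[R]_d) (Mk : set nat)
  (secant : forall i : nat, i \in Mk -> Bk *m s i = y i)
  (i : nat) (i_mem : i \in Mk) (i_lt_k : (i < k)%N) :
  enorm ((Bk - hessian f (x k)) *m s i)
    <= L * enorm (s i) * \sum_(i <= j < k) enorm (s j).
Proof.
case: f_C2 => _ dgrad _.
have [/enorm_eq0 ->|si0] := eqVneq (enorm (s i)) 0.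
  by rewrite mulmx0 enorm0 mulr0 mul0r.
(* In dimension 0 the constant L may be negative, so its sign is drawn from
   a nonzero step. *)
have L0 : 0 <= L.
  (* The left-hand side of the Lipschitz bound between s i and 0 is >= 0. *)
  have si_gt0 : 0 < enorm (s i) by rewrite lt_neqAle eq_sym si0 enorm_ge0.
  rewrite -(pmulr_lge0 _ si_gt0) -[s i]subr0.
  exact: le_trans (spectral_norm_ge0 _) (hess_lip _ _).
rewrite mulmxBl secant // y_def x_step.
have [c c01 err] :=
  gradient_linearization_error (hessian f (x k)) (x i) (s i) dgrad.
apply: (le_trans err).
rewrite mulrAC ler_wpM2r ?enorm_ge0 //; apply: (le_trans (hess_lip _ _)).
rewrite ler_wpM2l //; apply: enorm_segment_to_iterate => //.
by move: c01; rewrite in_itv /= => /andP[/ltW -> /ltW ->].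
Qed.
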